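(* Let $n\ge 1$, let $a$ be a nonzero integer, let $f_1(X),\ldots,f_n(X)\in\mathbb{Z}[X]$ be $n$ polynomials of degrees at most $d$, and let $k_1,\ldots,k_n\ge 1$ be odd integers. For any fixed integer $r\ge 1$ there is a constant $C(r)$, depending only on $r$, such that, uniformly over all boxes $$\mathfrak{B}=[u_1+1,u_1+h]\times\cdots\times[u_n+1,u_n+h]$$ (with integers $u_1,\ldots,u_n$ and $h\ge 1$) satisfying $$\max_{i=1,\ldots,n}|u_i|\le \exp\big(C(r)h^{4/9}\big),$$ we have $$N^*_{a,\vec f,\vec k}(\mathfrak{B})\ll h^{n-4r/9},$$ provided that $$n>(d+1)(d+2)\,2^{r}\max\{2r,\;3r-9/2\}+2.$$
   Context: For $\vec f=(f_1,\ldots,f_n)$ and $\vec k=(k_1,\ldots,k_n)$, $N^*_{a,\vec f,\vec k}(\mathfrak{B})$ denotes the number of integer solutions $(x_1,\ldots,x_n)\in\mathfrak{B}$ with $x_1\cdots x_n\neq 0$ of the equation $$f_1(x_1)+\cdots+f_n(x_n)=a\,x_1^{k_1}\cdots x_n^{k_n}.$$ The notation $A\ll B$ means $|A|\le cB$ for some constant $c$; here the implied constants may depend on the degrees $\deg f_i$, the coefficient $a$, the exponents $k_i$ ($i=1,\ldots,n$), and on $r$ (but not on $h$ or the $u_i$). *)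

(* Defs.v *)
From HB Require Import structures.
From mathcomp Require Import all_boot all_order all_algebra finmap.
From mathcomp Require Import all_classical all_reals all_analysis.

Set Implicit Arguments.
Unset Strict Implicit.
Unset Printing Implicit Defensive.

Import Order.TTheory GRing.Theory Num.Theory.

Local Open Scope classical_set_scope.
Local Open Scope ring_scope.

Definition box (n : nat) (u : 'I_n -> int) (h : nat) : set {ffun 'I_n -> int} :=
  [set x | forall i, u i + 1 <= x i <= u i + h%:Z].

Definition solutions (n : nat) (a : int) (f : 'I_n -> {poly int})
    (k : 'I_n -> nat) : set {ffun 'I_n -> int} :=
  [set x | \sum_(i < n) (f i).[x i] = a * \prod_(i < n) x i ^+ k i].

(* [fset_set] is the empty set on infinite sets, so this is the number of
   solutions only for finite B; boxes are finite by [finite_box] below. *)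
Definition Nstar (n : nat) (a : int) (f : 'I_n -> {poly int})
    (k : 'I_n -> nat) (B : set {ffun 'I_n -> int}) : nat :=
  #|` fset_set (B `&` [set x | \prod_(i < n) x i != 0] `&` solutions a f k) |.

Lemma finite_box (n : nat) (u : 'I_n -> int) (h : nat) : finite_set (box u h).
Proof.
pose g (t : {ffun 'I_n -> 'I_h}) : {ffun 'I_n -> int} :=
  [ffun i => u i + 1 + (t i : nat)%:Z].
apply: (@sub_finite_set _ _ (g @` [set: {ffun 'I_n -> 'I_h}])); last first.
  by apply: finite_image; exact: finite_finset.
move=> x xB.
have H i : (`|(x i - (u i + 1))%R|%N < h)%N.
  have /andP[l r] := xB i.
  rewrite -ltz_nat gez0_abs ?subr_ge0// ltrBlDl addrAC ltzD1 //.
exists [ffun i => Ordinal (H i)] => //.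
apply/ffunP => i; rewrite !ffunE /=.
have /andP[l _] := xB i.
by rewrite gez0_abs ?subr_ge0// addrC subrK.
Qed.

(* Main.v *)
Require Import Defs.
From mathcomp Require Import all_boot all_order all_algebra finmap.
From mathcomp Require Import all_classical all_reals all_analysis.
From mathcomp Require Import zify ring lra.

(** Split the coordinates into a set [Y] of [4 r] of them and its complement.
    A solution says that the point given by the partial sum and the partial
    product off [Y] lies on a line given by those in [Y].  Two points with
    distinct products are on at most one common line, so Cauchy-Schwarz bounds
    the number of solutions once points and lines have small multiplicity, i.e.
    once few [x] in the box share a given nonzero value of a partial product
    [prod x_i ^ k_i].  This multiplicity is [O(h)], uniformly in the box:
    distinct elements of an interval of length [h] have gcd below [h], so a
    coordinate with [|u_i|] maximal and larger than a fixed power of [h] takes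
    boundedly many values; once no such coordinate is left, the divisor bound
    applies. *)

Set Implicit Arguments.
Unset Strict Implicit.
Unset Printing Implicit Defensive.

Import Order.TTheory GRing.Theory Num.Theory.

(** * The divisor bound *)

(** A divisor [d] is [p ^ f * q] with [p ^ f = gcd(d, p ^ e)]. As [d] divides both [d * m] and
    [p ^ e * m], it divides [p ^ f * m], so [q] divides [m]. *)
Lemma size_divisors_pfactor p e m : prime p -> (0 < m)%N ->
  (size (divisors (p ^ e * m)) <= e.+1 * size (divisors m))%N.
Proof.
move=> pp m0; have pe0 : (0 < p ^ e)%N by rewrite expn_gt0 prime_gt0.
rewrite -[e.+1](size_iota 0) -(size_allpairs (fun f d => p ^ f * d)%N).
apply: uniq_leq_size (divisors_uniq _) _ => d.
rewrite -dvdn_divisors ?muln_gt0 ?pe0// => dpm.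
have [f fe Ef] := dvdn_pfactor _ e pp (dvdn_gcdr d (p ^ e)).
have [q Eq] : exists q, d = (p ^ f * q)%N.
  by rewrite -Ef; have /dvdnP[q Eq] := dvdn_gcdl d (p ^ e); exists q; rewrite mulnC.
apply/allpairsP; exists (f, q); split => //.
  by rewrite mem_iota /=; lia.
rewrite -dvdn_divisors//= -(@dvdn_pmul2l (p ^ f)) ?expn_gt0 ?prime_gt0//.
by rewrite -Eq -Ef muln_gcdl dvdn_gcd dpm dvdn_mulr.
Qed.

(** With [q = e %/ t], [e + 1 <= t * (q + 1) <= t * 2 ^ q], and [q * t <= e]. *)
Lemma expn_le_exp2 t e : (0 < t)%N -> (e.+1 ^ t <= t ^ t * 2 ^ e)%N.
Proof.
move=> t0; apply: (@leq_trans ((t * 2 ^ (e %/ t)) ^ t)).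
  rewrite leq_exp2r// {1}(divn_eq e t).
  have := ltn_expl (e %/ t) (isT : 1 < 2)%N; have := ltn_pmod e t0.
  nia.
rewrite expnMn -expnM leq_mul2l leq_exp2l//.
by rewrite leq_divM orbT.
Qed.

(* Primes [>= 2 ^ t] contribute at most their own power to [tau m ^ t], and
   each of the remaining finitely many primes costs a factor [t ^ t]. *)
Lemma divisor_bound_rough t B : (0 < t)%N -> exists C, forall m, (0 < m)%N ->
  (forall p, prime p -> p %| m -> (p < B)%N || (2 ^ t <= p)%N) ->
  (size (divisors m) ^ t <= C * m)%N.
Proof.
move=> t0; elim: B => [|B [C IH]].
  exists 1; elim/ltn_ind => m IH m0 mP; rewrite mul1n.
  have [m1|m1] := leqP m 1; first by rewrite (_ : m = 1) ?exp1n; lia.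
  have pp := pdiv_prime m1; set p := pdiv m in pp.
  have [q cpq Em] := pfactor_coprime pp m0.
  have e0 : (0 < logn p m)%N by rewrite logn_gt0 pi_pdiv.
  set e := logn p m in Em e0.
  have tp : (2 ^ t <= p)%N by have := mP p pp (pdiv_dvd m); rewrite ltn0.
  have q0 : (0 < q)%N by move: m0; rewrite Em; case: (q).
  have pe1 : (1 < p ^ e)%N.
    by rewrite -(exp1n e) ltn_exp2r// prime_gt1.
  rewrite Em [(q * _)%N]mulnC.
  apply: leq_trans (_ : (e.+1 * size (divisors q)) ^ t <= _).
    by rewrite leq_exp2r// size_divisors_pfactor.
  rewrite expnMn leq_mul//; last first.
    rewrite -[q in (_ <= q)%N]mul1n; apply: IH => //; first by nia.
    by move=> p' pp' dp'; apply: mP => //; rewrite Em dvdn_mulr.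
  (* [e + 1 <= 2 ^ e], and [(2 ^ e) ^ t = (2 ^ t) ^ e <= p ^ e]. *)
  apply: leq_trans (_ : (2 ^ e) ^ t <= _); first by rewrite leq_exp2r// ltn_expl.
  by rewrite -expnM mulnC expnM leq_exp2r.
exists (t ^ t * C) => m m0 mP.
(* If [B] is not prime, the condition for [B.+1] already gives the one for [B]. *)
have [pB|npB] := boolP (prime B); last first.
  have : (C * m <= t ^ t * C * m)%N.
    by rewrite -mulnA leq_pmull// expn_gt0 t0.
  move=> le; apply: leq_trans le; apply: IH => // p pp dp.
  have := mP p pp dp; rewrite ltnS leq_eqVlt => /orP[/orP[/eqP E|->]|->]//.
    by rewrite -E pp in npB.
  by rewrite orbT.
have [q cpq Em] := pfactor_coprime pB m0; set e := logn B m in Em.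
have q0 : (0 < q)%N by move: m0; rewrite Em; case: (q).
rewrite Em [(q * _)%N]mulnC.
apply: leq_trans (_ : (e.+1 * size (divisors q)) ^ t <= _).
  by rewrite leq_exp2r// size_divisors_pfactor.
have Hq : (size (divisors q) ^ t <= C * q)%N.
  apply: IH => // p pp dp.
  have := mP p pp; rewrite Em dvdn_mulr// => /(_ isT).
  rewrite ltnS leq_eqVlt => /orP[/orP[/eqP E|->]|->]//; last by rewrite orbT.
  by rewrite E in dp; move: cpq; rewrite prime_coprime// dp.
rewrite expnMn; apply: leq_trans (leq_mul (expn_le_exp2 e t0) Hq) _.
have : (2 ^ e <= B ^ e)%N.
  by case: (e) => // e'; rewrite leq_exp2r// prime_gt1.
nia.
Qed.

(** For [B = 2 ^ t] the range of excluded primes is empty. *)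
Lemma divisor_bound t : (0 < t)%N -> exists C, forall m, (0 < m)%N ->
  (size (divisors m) ^ t <= C * m)%N.
Proof.
move=> t0; have [C HC] := divisor_bound_rough (2 ^ t) t0.
by exists C => m m0; apply: HC => // p _ _; case: ltnP.
Qed.

(** * Divisors of an integer in a short interval *)

Lemma dvdn_gcdMl a b c : gcdn (a * b) c %| gcdn a c * gcdn b c.
Proof.
have gab := dvdn_gcdl (a * b) c; have gc := dvdn_gcdr (a * b) c.
rewrite muln_gcdr dvdn_gcd (dvdn_mull _ gc) andbT.
by rewrite muln_gcdl dvdn_gcd gab dvdn_mulr.
Qed.

Local Open Scope ring_scope.

(* Distinct divisors of [A] in an interval of length [h] are nearly coprime. *)
Lemma prod_close_divisors (s : seq int) (A h : nat) : (0 < h)%N -> uniq s ->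
  {in s, forall x, (`|x| %| A)%N} ->
  {in s &, forall x y, (`|x - y| <= h)%N} ->
  exists V, [/\ (0 < V)%N, (V <= h ^ (size s ^ 2))%N &
    (\prod_(x <- s) `|x| %| A * V)%N].
Proof.
move=> h0; elim: s => [|y s IH] /=; first by exists 1%N; rewrite big_nil dvd1n.
move=> /andP[ys us] sA sh.
have [|||V [V0 Vh VA]] := IH => //.
- by move=> x xs; apply: sA; rewrite inE xs orbT.
- by move=> x z xs zs; apply: sh; rewrite inE ?xs ?zs orbT.
(* [W] is the product of the [|x - y|], because [gcd(x, y)] divides [x - y]. *)
have [W [W0 Wh HW]] : exists W, [/\ (0 < W)%N, (W <= h ^ size s)%N &
    (gcdn (\prod_(x <- s) `|x|) `|y| %| W)%N].
  have : {in s, forall x, (`|x - y| <= h)%N && (0 < `|x - y|)%N}.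
    move=> x xs; rewrite sh ?inE ?xs ?eqxx ?orbT//= absz_gt0 subr_eq0.
    by apply: contra ys => /eqP <-.
  elim: (s) => [_|z s' IH' sh'] /=.
    by exists 1%N; rewrite big_nil gcd1n.
  have [W [W0 Wh WA]] : exists W, [/\ (0 < W)%N, (W <= h ^ size s')%N &
    (gcdn (\prod_(x <- s') `|x|) `|y| %| W)%N].
    by apply: IH' => x xs; apply: sh'; rewrite inE xs orbT.
  have /andP[zh z0] := sh' z (mem_head _ _).
  exists (`|(z - y)%R| * W)%N; rewrite muln_gt0 z0 W0 expnS leq_mul//; split => //.
  rewrite big_cons; apply: dvdn_trans (dvdn_gcdMl _ _ _) _; apply: dvdn_mul => //.
  have := dvdn_gcdl `|z| `|y|; have := dvdn_gcdr `|z| `|y|.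
  set g := gcdn `|z| `|y|.
  have gE (w : int) : (g %| `|w|)%N = (g%:Z %| w)%Z by [].
  by rewrite !gE => gy gz; rewrite rpredB.
exists (V * W)%N; rewrite muln_gt0 V0 W0; split => //.
  apply: leq_trans (leq_mul Vh Wh) _; rewrite -expnD leq_pexp2l//; nia.
(* The new product is lcm times gcd: the lcm divides [A * V], the gcd divides [W]. *)
rewrite big_cons mulnC -muln_lcm_gcd mulnA dvdn_mul// dvdn_lcm VA/=.
by rewrite dvdn_mulr// sA// inE eqxx.
Qed.

(** The product of [2 * K + 2] such divisors would be at least [(U / 2) ^ (2 * K + 2)] and at most
    [A * V <= (2 * U) ^ K * U]. This forces [U ^ (K + 1) <= 2 ^ (3 * K + 2) < 8 ^ (K + 1)], against
    [8 < U]. *)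
Lemma few_close_divisors (s : seq int) (A h U K : nat) : (0 < h)%N -> uniq s ->
  (0 < A)%N ->
  {in s, forall x, (`|x| %| A)%N} ->
  {in s &, forall x y, (`|x - y| <= h)%N} ->
  {in s, forall x, (U <= 2 * `|x|)%N} ->
  (A <= (2 * U) ^ K)%N -> (8 * h ^ (2 * K + 2) ^ 2 < U)%N ->
  (size s <= 2 * K + 2)%N.
Proof.
move=> h0 us A0 sA sh sU AU hU; rewrite leqNgt; apply/negP => sK.
pose s' := take (2 * K + 2) s.
have ss' : {subset s' <= s} by move=> x /mem_take.
have size_s' : size s' = (2 * K + 2)%N by rewrite size_take sK.
have [|||V [V0 Vh /dvdn_leq]] := @prod_close_divisors s' A h h0.
- exact: take_uniq.
- by move=> x /ss'; apply: sA.
- by move=> x y /ss' xs /ss' ys; apply: sh.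
rewrite muln_gt0 A0 V0 => /(_ isT) le1.
have le2 : (U ^ (2 * K + 2) <= 2 ^ (2 * K + 2) * \prod_(x <- s') `|x|)%N.
  rewrite -size_s'; have : {in s', forall x, (U <= 2 * `|x|)%N}.
    by move=> x /ss'; apply: sU.
  elim: (s') => [|y t IH] tU; first by rewrite big_nil.
  rewrite /= big_cons !expnS mulnACA leq_mul ?tU ?mem_head// IH//.
  by move=> x xt; apply: tU; rewrite inE xt orbT.
rewrite size_s' in Vh.
have U0 : (0 < U)%N by lia.
have : (U ^ (2 * K + 2) <= 2 ^ (2 * K + 2) * ((2 * U) ^ K * U))%N.
  apply: leq_trans le2 _; rewrite leq_mul2l; apply/orP; right.
  apply: leq_trans le1 _; apply: leq_mul => //.
  by apply: leq_trans Vh _; lia.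
apply/negP; rewrite -ltnNge.
have -> : (2 ^ (2 * K + 2) * ((2 * U) ^ K * U) = 2 ^ (3 * K + 2) * U ^ K.+1)%N.
  by rewrite expnMn expnSr (_ : 3 * K + 2 = (2 * K + 2) + K)%N ?expnD; lia.
rewrite (_ : 2 * K + 2 = K.+1 + K.+1)%N; last by lia.
rewrite [(U ^ (_ + _))%N]expnD ltn_pmul2r ?expn_gt0 ?U0//.
apply: leq_trans (_ : 8 ^ K.+1 <= _)%N; last by rewrite leq_exp2r//; lia.
by rewrite (_ : 8 = 2 ^ 3)%N// -expnM ltn_exp2l//; lia.
Qed.

(** * Multiplicity of partial products on a box *)

Lemma leq_card_fibers (T U : finType) (f : T -> U) (A : {set T}) (M : nat) :
  (forall y, (#|[set x in A | f x == y]| <= M)%N) -> (#|A| <= #|f @: A| * M)%N.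
Proof.
move=> fM; rewrite -sum1_card (partition_big_imset f) -sum_nat_const/=.
apply: leq_sum => y _; apply: leq_trans (fM y).
by rewrite -sum1_card; apply/eq_leq/eq_bigl => x; rewrite inE.
Qed.

(** The box is parametrised by the finite type of functions [t] into ['I_h], so that its subsets are
    finite sets with a cardinal. *)
Definition point (n h : nat) (u : 'I_n -> int) (t : {ffun 'I_n -> 'I_h})
    (i : 'I_n) : int := u i + 1 + (t i : nat)%:Z.

Definition agree (n h : nat) (S : {set 'I_n}) (t w : {ffun 'I_n -> 'I_h}) :=
  [forall i in S, t i == w i].

Definition prod_on (n h : nat) (k : 'I_n -> nat) (u : 'I_n -> int)
    (S : {set 'I_n}) (t : {ffun 'I_n -> 'I_h}) : int :=
  \prod_(i in S) point u t i ^+ k i.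

Lemma absz_point_le (n h : nat) (u : 'I_n -> int) (t : {ffun 'I_n -> 'I_h}) i :
  (`|point u t i| <= `|u i| + h)%N.
Proof. by rewrite /point; have := ltn_ord (t i); lia. Qed.

Definition divisor_residues (n h : nat) (u : 'I_n -> int) (A : int) (i : 'I_n) : {set 'I_h} :=
  [set j : 'I_h | (`|(u i + 1 + (j : nat)%:Z)%R| %| `|A|)%N].

Lemma card_divisor_residues (n h : nat) (u : 'I_n -> int) (A : int) i : A != 0 ->
  (#|divisor_residues h u A i| <= 2 * size (divisors `|A|))%N.
Proof.
move=> A0; rewrite cardE -(size_map (fun j : 'I_h => u i + 1 + (j : nat)%:Z)).
rewrite mul2n -addnn -{1}(size_map Posz) -(size_map (fun d => - Posz d)) -size_cat.
apply: uniq_leq_size.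
  by rewrite map_inj_uniq ?enum_uniq// => j j' /addrI [] /val_inj.
move=> x /mapP[j]; rewrite mem_enum inE dvdn_divisors ?absz_gt0// => jA ->.
rewrite mem_cat; set y := (u i + 1 + _) in jA *.
have [y0|y0] := leP 0 y; apply/orP; [left|right]; apply/mapP; exists `|y|%N => //; lia.
Qed.

Section multiplicity.
Variables (n h : nat) (k : 'I_n -> nat) (u : 'I_n -> int).
Hypotheses (k0 : forall i, (0 < k i)%N) (h0 : (0 < h)%N).
Let K := (\sum_(i < n) k i)%N.

(** Freezing the coordinates off [S] at those of [w] makes the cardinal count choices on [S]
    alone. *)
Definition prod_fiber (S : {set 'I_n}) (w : {ffun 'I_n -> 'I_h}) (A : int) :=
  [set t | agree (~: S) t w && (prod_on k u S t == A)].

Lemma absz_prod_on (S : {set 'I_n}) (t : {ffun 'I_n -> 'I_h}) :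
  `|prod_on k u S t|%N = (\prod_(i in S) `|point u t i| ^ k i)%N.
Proof.
rewrite /prod_on (big_morph absz abszM absz1).
by apply: eq_bigr => i _; rewrite abszX.
Qed.

Lemma absz_prod_on_le (S : {set 'I_n}) (t : {ffun 'I_n -> 'I_h}) (M : nat) :
  (0 < M)%N -> {in S, forall i, (`|point u t i| <= M)%N} ->
  (`|prod_on k u S t| <= M ^ K)%N.
Proof.
move=> M0 SM; rewrite absz_prod_on.
apply: (@leq_trans (\prod_(i in S) M ^ k i)).
  by apply: leq_prod => i iS; rewrite leq_exp2r ?k0// SM.
rewrite -expn_sum leq_pexp2l// /K [leqRHS](bigID (mem S))/=; exact: leq_addr.
Qed.

Lemma point_dvd_prod_on (S : {set 'I_n}) (t : {ffun 'I_n -> 'I_h}) i :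
  i \in S -> (`|point u t i| %| `|prod_on k u S t|)%N.
Proof.
move=> iS; rewrite absz_prod_on (bigD1 i)//= dvdn_mulr//.
by rewrite dvdn_exp// k0.
Qed.

(** Each coordinate in [S] is a divisor of [A] up to sign, and each other one is frozen. *)
Lemma card_prod_fiber_small (S : {set 'I_n}) w (A : int) : A != 0 ->
  (#|prod_fiber S w A| <= (2 * size (divisors `|A|)) ^ n)%N.
Proof.
move=> A0; have D0 : (0 < 2 * size (divisors `|A|))%N.
  rewrite muln_gt0/= lt0n size_eq0; apply/eqP => D.
  have := dvdn_divisors 1 (m := `|A|%N); rewrite absz_gt0 A0 dvd1n D => /(_ isT).
  by rewrite in_nil.
pose F (i : 'I_n) : {set 'I_h} := if i \in S then divisor_residues h u A i else [set w i].
apply: (@leq_trans #|family (fun i => mem (F i))|).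
  apply/subset_leq_card/fintype.subsetP => t; rewrite inE => /andP[tw /eqP tA].
  apply/familyP => i; rewrite /F; case: ifPn => iS.
    by rewrite inE -tA point_dvd_prod_on.
  by move/forall_inP: tw => /(_ i); rewrite !inE iS; apply.
rewrite card_family foldrE big_image/=.
apply: (@leq_trans (\prod_(i < n) (2 * size (divisors `|A|)))%N).
  apply: leq_prod => i _; rewrite /F; case: ifPn => iS.
    exact: card_divisor_residues.
  by rewrite cards1.
by rewrite prod_nat_const card_ord.
Qed.

(** All coordinates in [S] are at most [2 * |u i|] in size, so [|A| <= (2 * |u i|) ^ K]. The values
    of coordinate [i] are close divisors of [A] of size at least [|u i| / 2], hence at most
    [2 * K + 2] in number. Fixing one of them leaves a fiber over [S :\ i]. *)
Lemma prod_fiber_step (S : {set 'I_n}) w (A : int) (M : nat) (i : 'I_n) :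
  i \in S -> A != 0 ->
  (forall l, l \in S -> (`|u l| <= `|u i|)%N) ->
  (8 * h ^ (2 * K + 2) ^ 2 < `|u i|)%N ->
  (forall w' (A' : int), A' != 0 -> (#|prod_fiber (S :\ i) w' A'| <= M)%N) ->
  (#|prod_fiber S w A| <= (2 * K + 2) * M)%N.
Proof.
move=> iS A0 imax ibig IH.
have hu : (2 * h <= `|u i|)%N.
  suff : (h <= h ^ (2 * K + 2) ^ 2)%N by lia.
  by rewrite -{1}(expn1 h) leq_pexp2l// expn_gt0; lia.
pose f (t : {ffun 'I_n -> 'I_h}) := t i.
apply: (@leq_trans (#|f @: prod_fiber S w A| * M)%N); last first.
  rewrite leq_mul2r; apply/orP; right.
  have [->|[t1 t1P]] := set_0Vmem (prod_fiber S w A); first by rewrite imset0 cards0.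
  rewrite cardE -(size_map (fun j : 'I_h => u i + 1 + (j : nat)%:Z)).
  apply: (@few_close_divisors _ `|A|%N h `|u i|%N K) => //.
  - by rewrite map_inj_uniq ?enum_uniq// => j j' /addrI [] /val_inj.
  - by rewrite absz_gt0.
  - move=> x /mapP[j]; rewrite mem_enum => /imsetP[t]; rewrite inE => /andP[_ /eqP <-] -> ->.
    exact: point_dvd_prod_on.
  - by move=> x y /mapP[j _ ->] /mapP[j' _ ->]; have := ltn_ord j; have := ltn_ord j'; lia.
  - by move=> x /mapP[j _ ->]; have := ltn_ord j; lia.
  - move: t1P; rewrite inE => /andP[_ /eqP <-]; apply: absz_prod_on_le; first by lia.
    by move=> l lS; have := absz_point_le u t1 l; have := imax l lS; lia.
apply: leq_card_fibers => j.
set B := [set x in _ | _].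
have [->|[t0 t0B]] := set_0Vmem B; first by rewrite cards0.
have prodD t : prod_on k u S t = point u t i ^+ k i * prod_on k u (S :\ i) t.
  rewrite /prod_on (bigD1 i)//=; congr (_ * _); apply: eq_bigl => l.
  by rewrite !inE andbC.
have BE t : t \in B -> t i = j /\ prod_on k u S t = A.
  by rewrite !inE => /andP[/andP[_ /eqP ->] /eqP].
have [t0i t0A] := BE _ t0B.
have A'0 : point u t0 i ^+ k i != 0 /\ prod_on k u (S :\ i) t0 != 0.
  by move: A0; rewrite -t0A prodD mulf_eq0 negb_or => /andP.
apply: leq_trans (IH [ffun l => if l == i then j else w l] _ A'0.2).
apply/subset_leq_card/fintype.subsetP => t tB.
have [ti tA] := BE _ tB; rewrite inE; apply/andP; split.
  apply/forall_inP => l; rewrite !inE negb_and negbK ffunE.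
  have [->|li] := eqVneq l i; first by rewrite ti.
  move=> lS; move: tB; rewrite !inE => /andP[/andP[/forall_inP tw _] _].
  by apply: tw; rewrite inE.
apply/eqP/(mulfI A'0.1); rewrite -prodD t0A.
by rewrite /point t0i -ti -/(point u t i) -prodD.
Qed.

End multiplicity.

Lemma prod_fiber_bound (n : nat) (k : 'I_n -> nat) : (forall i, (0 < k i)%N) ->
  exists c, forall h, (0 < h)%N -> forall u S (w : {ffun 'I_n -> 'I_h}) (A : int),
  A != 0 -> (#|prod_fiber k u S w A| <= c * h)%N.
Proof.
move=> k0; pose K := (\sum_(i < n) k i)%N; pose E := ((2 * K + 2) ^ 2)%N.
have E0 : (0 < E)%N by rewrite expn_gt0; lia.
have [n0|n0] := posnP n.
  exists 1%N => h h0 u S w A A0; rewrite mul1n.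
  apply: leq_trans (max_card _) _.
  by rewrite card_ffun !card_ord [X in (_ ^ X)%N]n0.
(* Once all [|u i| <= 8 * h ^ E], [|A| <= (9 * h ^ E) ^ K]. This exponent makes the [(K * E + 1)]-th
   power of [(2 * tau A) ^ n] at most [c0 * h ^ (K * E)]. *)
have [|C HC] := @divisor_bound (n * (K * E + 1)); first by rewrite muln_gt0 n0; lia.
pose c0 := (2 ^ (n * (K * E + 1)) * (C * 9 ^ K))%N.
exists ((2 * K + 2) ^ n * c0)%N => h h0 u S w A A0.
have small (S' : {set 'I_n}) (w' : {ffun 'I_n -> 'I_h}) (A' : int) : A' != 0 ->
    {in S', forall i, (`|u i| <= 8 * h ^ E)%N} ->
    (#|prod_fiber k u S' w' A'| <= c0 * h)%N.
  move=> A'0 S'u.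
  have [->|[t]] := set_0Vmem (prod_fiber k u S' w' A'); first by rewrite cards0.
  rewrite inE => /andP[_ /eqP tA].
  have AK : (`|A'| <= (9 * h ^ E) ^ K)%N.
    rewrite -tA; apply: absz_prod_on_le => //; first by rewrite muln_gt0 expn_gt0 h0.
    move=> i iS; have := absz_point_le u t i; have := S'u i iS.
    have : (h <= h ^ E)%N by rewrite -{1}(expn1 h) leq_pexp2l.
    lia.
  apply: leq_trans (card_prod_fiber_small u k0 S' w' A'0) _.
  have Hd := HC `|A'|%N; rewrite absz_gt0 in Hd; have {}Hd := Hd A'0.
  rewrite -(@leq_exp2r _ _ (K * E + 1)); last by rewrite addn1.
  rewrite -expnM expnMn.
  apply: leq_trans (leq_mul (leqnn _) (leq_trans Hd (leq_mul (leqnn C) AK))) _.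
  rewrite expnMn -expnM [(C * _)%N]mulnA mulnA -/c0 mulnC [(E * K)%N]mulnC.
  rewrite expnMn mulnC; apply: leq_mul; last by rewrite leq_pexp2l//; lia.
  have [->//|c00] := posnP c0.
  by rewrite -{1}(expn1 c0) leq_pexp2l//; lia.
apply: (@leq_trans ((2 * K + 2) ^ #|S| * c0 * h)%N); last first.
  rewrite !leq_mul2r leq_pexp2l ?orbT//; first by lia.
  by have := max_card (mem S); rewrite card_ord.
(* Strip off a coordinate with maximal [|u i|], at the cost of a factor [2 * K + 2], until [small]
   applies. *)
move Em : #|S| => m; elim: m S Em w A A0 => [|m IH] S Sm w A A0.
  rewrite expn0 mul1n; apply: small => // i; by rewrite (cards0_eq Sm) inE.
have [/forall_inP Su|] := boolP [forall i in S, (`|u i| <= 8 * h ^ E)%N].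
  apply: leq_trans (small S w A A0 Su) _.
  by rewrite -mulnA leq_pmull// expn_gt0; lia.
rewrite negb_forall_in => /exists_inP[i1 i1S i1u].
have [i iS imax] := @arg_maxnP _ i1 (mem S) (fun l => `|u l|%N) i1S.
rewrite expnS -(mulnA _ _ c0) -(mulnA _ _ h); apply: (@prod_fiber_step _ _ _ _ k0 h0 _ _ _ _ i iS A0) => //.
  by move: i1u; rewrite -ltnNge => i1u; apply: leq_trans i1u (imax _ i1S).
move=> w' A' A'0; apply: IH => //.
by move: Sm; rewrite (cardsD1 i S) (iS : i \in S) => -[].
Qed.

(** * Cauchy-Schwarz and collisions *)

Lemma sq_sum_le (I : finType) (A : {set I}) (c : I -> nat) :
  ((\sum_(i in A) c i) ^ 2 <= #|A| * \sum_(i in A) c i ^ 2)%N.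
Proof.
rewrite -(@leq_pmul2l 2)// expnS expn1 !big_distrlr/=.
have -> : (2 * (#|A| * \sum_(i in A) c i ^ 2) =
  \sum_(i in A) \sum_(j in A) (c i ^ 2 + c j ^ 2))%N.
  under [RHS]eq_bigr do rewrite big_split/= sum_nat_const.
  by rewrite big_split/= sum_nat_const -big_distrr/= mul2n addnn.
rewrite big_distrr/=; apply: leq_sum => i _.
by rewrite big_distrr/=; apply: leq_sum => j _; rewrite nat_Cauchy.
Qed.

(** The fiber sizes sum to [#|A|] and their squares to the number of colliding pairs. *)
Lemma sq_card_le_collisions (T U : finType) (f : T -> U) (A : {set T}) :
  (#|A| ^ 2 <= #|f @: A| * #|[set p in finset.setX A A | f p.1 == f p.2]|)%N.
Proof.
pose c y := #|[set x in A | f x == y]|.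
have -> : #|A| = (\sum_(y in f @: A) c y)%N.
  rewrite -sum1_card (partition_big_imset f)/=; apply: eq_bigr => y _.
  by rewrite /c -sum1_card; apply: eq_bigl => x; rewrite inE.
have -> : #|[set p in finset.setX A A | f p.1 == f p.2]| = (\sum_(y in f @: A) c y ^ 2)%N.
  transitivity (\sum_(x in A) c (f x))%N.
    rewrite -sum1_card (eq_bigl (fun p : T * T => (p.1 \in A) && ((p.2 \in A) && (f p.2 == f p.1)))).
      rewrite -(pair_big_dep (mem A) (fun x y => (y \in A) && (f y == f x)) (fun _ _ => 1%N))/=.
      apply: eq_bigr => x _; rewrite sum1_card /c.
      by apply: eq_card => y; rewrite inE.
    by move=> [x y]; rewrite !inE/= andbA [f x == _]eq_sym.
  rewrite (partition_big_imset f)/=; apply: eq_bigr => y _.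
  rewrite (eq_bigr (fun=> c y)); last by move=> x /andP[_ /eqP ->].
  rewrite sum_nat_const expnS expn1; congr (_ * _)%N.
  by apply: eq_card => x; rewrite !inE.
exact: sq_sum_le.
Qed.

(** * Incidences between points and lines *)

Section counting.
Variables (n h : nat) (k : 'I_n -> nat) (u : 'I_n -> int) (g : 'I_n -> int -> int) (a : int).
Implicit Types (S : {set 'I_n}) (t w : {ffun 'I_n -> 'I_h}).

Definition sum_on S t : int := \sum_(i in S) g i (point u t i).

Definition sol_set : {set {ffun 'I_n -> 'I_h}} :=
  [set t | (\prod_(i < n) point u t i != 0) &&
     (\sum_(i < n) g i (point u t i) == a * \prod_(i < n) point u t i ^+ k i)].

Lemma eq_sum_on S t w : {in S, t =1 w} -> sum_on S t = sum_on S w.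
Proof. by move=> tw; apply: eq_bigr => i iS; rewrite /point tw. Qed.

Lemma eq_prod_on S t w : {in S, t =1 w} -> prod_on k u S t = prod_on k u S w.
Proof. by move=> tw; apply: eq_bigr => i iS; rewrite /point tw. Qed.

(** The incidence relation: the point (product, sum) off [S] lies on the line of slope
    [a * prod_on k u S t] and intercept [- sum_on S t]. *)
Lemma sol_setP S t : t \in sol_set ->
  [/\ prod_on k u S t != 0, prod_on k u (~: S) t != 0 &
   sum_on S t + sum_on (~: S) t = a * (prod_on k u S t * prod_on k u (~: S) t)].
Proof.
rewrite inE => /andP[t0 /eqP tE]; split.
- apply/prodf_neq0 => i _; rewrite expf_neq0//.
  by move/prodf_neq0: t0; apply.
- apply/prodf_neq0 => i _; rewrite expf_neq0//.
  by move/prodf_neq0: t0; apply.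
- transitivity (\sum_(i < n) g i (point u t i)).
    rewrite [RHS](bigID (mem S))/=; congr (_ + _).
    by apply: eq_bigl => i; rewrite inE.
  rewrite tE; congr (_ * _); rewrite [LHS](bigID (mem S))/=; congr (_ * _).
  by apply: eq_bigl => i; rewrite inE.
Qed.

(** The filler [j0] off [S] keeps restrictions in the same type; equal restrictions mean agreement
    on [S]. *)
Definition restrict (j0 : 'I_h) S t : {ffun 'I_n -> 'I_h} :=
  [ffun i => if i \in S then t i else j0].

Lemma restrict_eq j0 S t w : restrict j0 S t = restrict j0 S w -> {in S, t =1 w}.
Proof. by move=> /ffunP E i iS; have := E i; rewrite !ffunE iS. Qed.

Lemma card_restrict j0 S (X : {set {ffun 'I_n -> 'I_h}}) :
  (#|restrict j0 S @: X| <= h ^ #|S|)%N.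
Proof.
apply: (@leq_trans #|pffun_on j0 (mem S) predT|); last first.
  by rewrite card_pffun_on card_ord.
apply/subset_leq_card/fintype.subsetP => _ /imsetP[t _ ->].
apply/pffun_onP; split; last by [].
by apply/supportP => i iS; rewrite ffunE (negbTE iS).
Qed.

(** Collisions are pairs of solutions that agree on [Y], that is, two points on one line. They are
    split by whether the products off [Y] coincide. *)
Lemma sq_card_sol_set (Y : {set 'I_n}) (M : nat) : a != 0 -> (0 < h)%N ->
  (forall S w (A : int), A != 0 -> (#|prod_fiber k u S w A| <= M)%N) ->
  (#|sol_set| ^ 2 <= h ^ #|Y| * (#|sol_set| * M + (h ^ #|~: Y|) ^ 2 * M))%N.
Proof.
move=> a0 h0 HM; pose j0 : 'I_h := Ordinal h0.
apply: leq_trans (sq_card_le_collisions (restrict j0 Y) sol_set) _.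
apply: leq_mul; first exact: card_restrict.
set D := [set p in _ | _].
pose E := [set p : {ffun 'I_n -> 'I_h} * {ffun 'I_n -> 'I_h} |
  prod_on k u (~: Y) p.1 == prod_on k u (~: Y) p.2].
rewrite -(cardsID E D); apply: leq_add.
  (* Equal products: given the first solution, the second lies in a fiber over [~: Y]. *)
  apply: (@leq_trans (#|fst @: (D :&: E)| * M)%N); last first.
    rewrite leq_mul2r; apply/orP; right; apply/subset_leq_card/fintype.subsetP => t.
    move=> /imsetP[[t1 t2] /finset.setIP[pD _] ->].
    by move: pD; rewrite [_ \in D]inE => /andP[/finset.setXP[]].
  apply: leq_card_fibers => t; set B := [set x in _ | _].
  have [->|[[t0 w0] p0B]] := set_0Vmem B; first by rewrite cards0.
  have BP t1 t2 : (t1, t2) \in B -> [/\ t1 = t, t \in sol_set, {in Y, t2 =1 t} &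
      prod_on k u (~: Y) t2 = prod_on k u (~: Y) t].
    rewrite [_ \in B]inE => /andP[/finset.setIP[pD pE] /eqP pt].
    move: pD; rewrite [_ \in D]inE => /andP[/finset.setXP[p1 p2] /eqP pr].
    rewrite -pt; split => //; first by move=> i iY; rewrite (restrict_eq pr).
    by move: pE; rewrite inE => /eqP.
  have [_ /(sol_setP Y)[_ Q0 _] _ _] := BP _ _ p0B.
  apply: leq_trans (HM (~: Y) t _ Q0).
  apply: leq_trans (leq_imset_card (pair t) _).
  apply/subset_leq_card/fintype.subsetP => -[t1 t2] /BP[-> _ agr Qt].
  apply: imset_f; rewrite inE Qt eqxx andbT finset.setCK.
  by apply/forall_inP => i iY; rewrite agr.
pose F (p : {ffun 'I_n -> 'I_h} * {ffun 'I_n -> 'I_h}) :=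
  (restrict j0 (~: Y) p.1, restrict j0 (~: Y) p.2).
(* Distinct products: the two points off [Y] determine the product on [Y], so the first solution
   lies in a fiber over [Y], and it determines the second through [merge]. *)
apply: (@leq_trans (#|F @: (D :\: E)| * M)%N); last first.
  rewrite leq_mul2r; apply/orP; right.
  apply: (@leq_trans #|finset.setX (restrict j0 (~: Y) @: sol_set) (restrict j0 (~: Y) @: sol_set)|).
    apply/subset_leq_card/fintype.subsetP => _ /imsetP[[t1 t2] pDE ->].
    move: pDE => /finset.setDP[]; rewrite [_ \in D]inE => /andP[/finset.setXP[p1 p2] _] _.
    by apply/finset.setXP; split; apply: imset_f.
  by rewrite cardsX expnS expn1 leq_mul// card_restrict.
apply: leq_card_fibers => z; set B := [set x in _ | _].
have [->|[[t0 w0] p0B]] := set_0Vmem B; first by rewrite cards0.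
have BP t w : (t, w) \in B -> [/\ t \in sol_set, w \in sol_set, {in Y, t =1 w},
    prod_on k u (~: Y) t != prod_on k u (~: Y) w &
    (restrict j0 (~: Y) t, restrict j0 (~: Y) w) = z].
  rewrite [_ \in B]inE => /andP[/finset.setDP[pD pE] /eqP pz].
  move: pD; rewrite [_ \in D]inE => /andP[/finset.setXP[p1 p2] /eqP pr].
  split => //; first exact: restrict_eq pr.
  by move: pE; rewrite inE.
have [t0s w0s t0w0 Q0 Ez0] := BP _ _ p0B.
have [P0 _ t0E] := sol_setP Y t0s; have [_ _ w0E] := sol_setP Y w0s.
apply: leq_trans (HM Y t0 _ P0).
pose merge (t : {ffun 'I_n -> 'I_h}) := [ffun i => if i \in Y then t i else w0 i].
apply: leq_trans (leq_imset_card (fun t => (t, merge t)) _).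
apply/subset_leq_card/fintype.subsetP => -[t w] /BP[ts ws tw Q Ez].
have [_ _ tE] := sol_setP Y ts; have [_ _ wE] := sol_setP Y ws.
have [/restrict_eq tt0 /restrict_eq ww0] :
    restrict j0 (~: Y) t = restrict j0 (~: Y) t0 /\
    restrict j0 (~: Y) w = restrict j0 (~: Y) w0.
  by move: Ez; rewrite -Ez0 => -[].
apply/imsetP; exists t; last first.
  congr (_, _); apply/ffunP => i; rewrite ffunE; case: ifPn => iY; first by rewrite tw.
  by apply: ww0; rewrite inE.
rewrite inE; apply/andP; split; first by apply/forall_inP => i /tt0 ->.
rewrite -(eq_sum_on tw) -(eq_prod_on tw) in wE.
rewrite -(eq_sum_on t0w0) -(eq_prod_on t0w0) in w0E.
rewrite (eq_sum_on tt0) (eq_prod_on tt0) in tE.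
rewrite (eq_sum_on ww0) (eq_prod_on ww0) in wE.
(* The sums cancel between the four equations, leaving [(q - q') * (a * (P - p)) = 0]. *)
rewrite -subr_eq0 in Q0; rewrite -subr_eq0; apply/eqP/(mulfI a0)/(mulfI Q0).
rewrite !mulr0; set P := prod_on k u Y t in tE wE *.
set p := prod_on k u Y t0 in t0E w0E *.
set q := prod_on _ _ _ t0 in tE t0E *; set q' := prod_on _ _ _ w0 in wE w0E *.
rewrite (_ : _ * _ = (a * (P * q) - a * (P * q')) - (a * (p * q) - a * (p * q'))).
  by rewrite -tE -wE -t0E -w0E; ring.
by ring.
Qed.

End counting.

(** * The bound for the number of solutions *)

Lemma card_sol_set_bound (n : nat) (k : 'I_n -> nat) (r : nat) : (0 < r)%N ->
  (5 * r + 1 <= n)%N -> (forall i, (0 < k i)%N) ->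
  exists c, forall h (u : 'I_n -> int) (g : 'I_n -> int -> int) (a : int),
  (0 < h)%N -> a != 0 -> (#|sol_set h k u g a| <= c * h ^ (n - r))%N.
Proof.
move=> r0 rn k0; have [c Hc] := prod_fiber_bound k0.
exists c.+1 => h u g a h0 a0.
pose Y := [set i : 'I_n | (i < 4 * r)%N].
have cY : #|Y| = (4 * r)%N.
  rewrite -sum1_card (eq_bigl (fun i : 'I_n => i < 4 * r)%N); last by move=> i; rewrite inE.
  rewrite -(big_ord_widen n (fun=> 1%N)); last by lia.
  by rewrite sum_nat_const card_ord muln1.
have cZ : #|~: Y| = (n - 4 * r)%N by have := cardsC Y; rewrite card_ord cY; lia.
have := @sq_card_sol_set n h k u g a Y (c * h) a0 h0.
rewrite cY cZ => /(_ (Hc h h0 u)).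
set N := #|_|; set X := (h ^ (n - r))%N => H.
have X0 : (0 < X)%N by rewrite expn_gt0 h0.
(* Exponents: [4r + 1 <= n - r] here, and [2n - 4r + 1 <= 2(n - r)] next. *)
have e1 : (h ^ (4 * r) * h <= X)%N by rewrite -expnSr leq_pexp2l//; lia.
have e2 : (h ^ (4 * r) * (h ^ (n - 4 * r)) ^ 2 * h <= X ^ 2)%N.
  by rewrite -!expnM -expnD -expnSr leq_pexp2l//; lia.
have : (N ^ 2 <= c * N * X + c * X ^ 2)%N.
  apply: leq_trans H _; rewrite mulnDr; apply: leq_add.
    by rewrite (_ : _ * _ = c * N * (h ^ (4 * r) * h))%N ?leq_mul2l ?e1 ?orbT//; lia.
  by rewrite (_ : _ * _ = c * (h ^ (4 * r) * (h ^ (n - 4 * r)) ^ 2 * h))%N ?leq_mul2l ?e2 ?orbT//; lia.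
(* [N > (c + 1) * X] would give [N ^ 2 > c * N * X + c * X ^ 2]. *)
clear -X0; nia.
Qed.

Local Open Scope classical_set_scope.

Lemma Nstar_le_card_sol_set (n : nat) (a : int) (f : 'I_n -> {poly int})
    (k : 'I_n -> nat) (u : 'I_n -> int) (h : nat) :
  (Nstar a f k (box u h) <= #|sol_set h k u (fun i x => (f i).[x]) a|)%N.
Proof.
pose e (t : {ffun 'I_n -> 'I_h}) : {ffun 'I_n -> int} := [ffun i => point u t i].
rewrite /Nstar cardE -(size_map e).
apply: uniq_leq_size => [|x]; first exact: fset_uniq.
rewrite in_fset_set; last first.
  by apply: sub_finite_set (finite_box u h) => y [[]].
rewrite inE => -[[xB /= x0] xE].
have H i : (`|(x i - (u i + 1))%R|%N < h)%N.
  have /andP[l r] := xB i.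
  by rewrite -ltz_nat gez0_abs ?subr_ge0// ltrBlDl addrAC ltzD1.
pose t : {ffun 'I_n -> 'I_h} := [ffun i => Ordinal (H i)].
have tx i : point u t i = x i.
  have /andP[l _] := xB i.
  by rewrite /point ffunE/= gez0_abs ?subr_ge0// addrC subrK.
apply/mapP; exists t; last by apply/ffunP => i; rewrite ffunE tx.
rewrite mem_enum inE; apply/andP; split.
  by rewrite (eq_bigr x).
apply/eqP; rewrite (eq_bigr (fun i => (f i).[x i])); last by move=> i _; rewrite tx.
by rewrite xE; congr (_ * _); apply: eq_bigr => i _; rewrite tx.
Qed.

(** The factors are at least [2], [2] and [2r], so [n > 8r + 2]. *)
Lemma leq_of_dimension_hypothesis (R : realType) (r d n : nat) : (1 <= r)%N ->
  ((d + 1) * (d + 2))%:R * 2 ^+ r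
    * Num.max (2 * r%:R) (3 * r%:R - 9 / 2) + 2 < n%:R :> R ->
  (5 * r + 1 <= n)%N.
Proof.
move=> r1 H; have {H} : (2 * 2 * (2 * r%:R) + 2 < n%:R :> R).
  apply: le_lt_trans H; rewrite lerD2r; apply: ler_pM.
  - by [].
  - by rewrite mulr_ge0.
  - apply: ler_pM => //; first by rewrite ler_nat; nia.
    by rewrite -[leLHS]expr1 ler_weXn2l// ler1n.
  - by rewrite le_max lexx.
rewrite -!natrM -natrD ltr_nat; lia.
Qed.

Theorem theorem1p1 (R : realType) (r : nat) (hr : (1 <= r)%N) :
  exists2 C : R, 0 < C &
  forall (n : nat) (a : int) (k : 'I_n -> nat) (s : 'I_n -> nat),
    (1 <= n)%N -> a != 0 -> (forall i, (1 <= k i)%N /\ odd (k i)) ->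
    (* s i = 1 + deg (f i), and 0 for the zero polynomial; the implied
       constant c depends on the degrees but not on the coefficients *)
    exists c : R,
      forall (d : nat) (f : 'I_n -> {poly int}),
        (forall i, size (f i) = s i) ->
        (forall i, (size (f i) <= d.+1)%N) ->
        ((d + 1) * (d + 2))%:R * 2 ^+ r
          * Num.max (2 * r%:R) (3 * r%:R - 9 / 2) + 2 < n%:R :> R ->
      forall (u : 'I_n -> int) (h : nat),
        (1 <= h)%N ->
        (\max_(i < n) `|u i|%N)%:R <= expR (C * h%:R `^ (4 / 9)) ->
        (Nstar a f k (box u h))%:R <= c * h%:R `^ (n%:R - 4 * r%:R / 9).
Proof.
exists 1 => // n a k s _ a0 k1.
(* [c] is chosen before [d]; when [n < 5r + 1] the dimension condition fails for every [d], and [0]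
   serves. *)
have [rn|nr] := leqP (5 * r + 1) n; last first.
  by exists 0 => d f _ _ /(leq_of_dimension_hypothesis hr); rewrite leqNgt nr.
have [c Hc] := card_sol_set_bound hr rn (fun i => proj1 (k1 i)).
exists c%:R => d f _ _ _ u h h0 _.
apply: (@le_trans _ _ (c * h ^ (n - r))%:R).
  by rewrite ler_nat (leq_trans (Nstar_le_card_sol_set _ _ _ _ _))// Hc.
(* As [h >= 1], it remains to compare exponents: [n - r <= n - 4r/9]. *)
rewrite natrM ler_wpM2l// natrX -powR_mulrn// ler_powR ?ler1n//.
rewrite natrB; last by lia.
by rewrite lerD2l lerN2; have := ler0n R r; lra.
Qed.
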